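(* Let $\mathcal{M}$ be a II$_1$-factor. Then $\operatorname{Comm}(\mathcal{M})$ contains all nilpotent elements of $\mathcal{M}$; that is, if $T\in\mathcal{M}$ satisfies $T^n=0$ for some integer $n\ge1$, then there exist $B,C\in\mathcal{M}$ such that $T=BC-CB$.
   Context: For an algebra $\mathfrak{A}$, the commutator of $B,C\in\mathfrak{A}$ is $[B,C]=BC-CB$, and $\operatorname{Comm}(\mathfrak{A})=\{[B,C] : B,C\in\mathfrak{A}\}$ is the set of all (single) commutators. *)

(* Defs.v *)
From HB Require Import structures.
From mathcomp Require Import all_boot all_order all_algebra.
From mathcomp Require Import all_classical all_reals all_analysis.
From mathcomp Require Export complex.

Set Implicit Arguments.
Unset Strict Implicit.
Unset Printing Implicit Defensive.

Import Order.TTheory GRing.Theory Num.Theory.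
Import numFieldNormedType.Exports.

Local Open Scope classical_set_scope.
Local Open Scope ring_scope.

(* A complex Hilbert space is a Banach space H over R[i] whose norm comes from
   an inner product, linear in its first argument.  Operators are plain
   functions H -> H: 0, -, + and *: on them are pointwise, and their product
   is composition. *)
Definition induces_norm (R : realType) (H : completeNormedModType R[i])
    (dot : {dot H for Num.conj}) : Prop :=
  forall x : H, `|x| ^+ 2 = dot x x.

Definition bounded_op (R : realType) (H : completeNormedModType R[i]) :
    set (H -> H) :=
  [set T | linear T /\ continuous T].

Definition is_adjoint (R : realType) (H : completeNormedModType R[i])
    (dot : {dot H for Num.conj}) (T S : H -> H) : Prop :=
  forall x y : H, dot (T x) y = dot x (S y).

Definition commutant (R : realType) (H : completeNormedModType R[i])
    (A : set (H -> H)) : set (H -> H) :=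
  [set T | bounded_op T /\ forall S, A S -> T \o S = S \o T].

Record von_neumann_algebra (R : realType) (H : completeNormedModType R[i])
    (dot : {dot H for Num.conj}) (M : set (H -> H)) : Prop := {
  vna_bounded : M `<=` @bounded_op R H ;
  vna_one : M idfun ;
  vna_add : forall S T, M S -> M T -> M (S + T) ;
  vna_scale : forall (c : R[i]) T, M T -> M (c *: T) ;
  vna_mul : forall S T, M S -> M T -> M (S \o T) ;
  vna_adjoint : forall T, M T -> exists2 S, M S & is_adjoint dot T S ;
  vna_bicommutant : commutant (commutant M) = M
}.

Definition factor (R : realType) (H : completeNormedModType R[i])
    (dot : {dot H for Num.conj}) (M : set (H -> H)) : Prop :=
  [/\ von_neumann_algebra dot M,
      (exists x : H, x != 0) &
      M `&` commutant M = range (fun c : R[i] => c *: (idfun : H -> H))].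

Definition projection_in (R : realType) (H : completeNormedModType R[i])
    (dot : {dot H for Num.conj}) (M : set (H -> H)) (p : H -> H) : Prop :=
  [/\ M p, p \o p = p & is_adjoint dot p p].

(* Murray-von Neumann equivalence p = v^* v, q = v v^* with v in M. *)
Definition mvn_equiv (R : realType) (H : completeNormedModType R[i])
    (dot : {dot H for Num.conj}) (M : set (H -> H)) (p q : H -> H) : Prop :=
  exists v w : H -> H,
    [/\ M v, M w, is_adjoint dot v w, w \o v = p & v \o w = q].

(* For projections, q <= p means p q = q. *)
Definition finite_projection (R : realType) (H : completeNormedModType R[i])
    (dot : {dot H for Num.conj}) (M : set (H -> H)) (p : H -> H) : Prop :=
  projection_in dot M p /\
  forall q, projection_in dot M q -> p \o q = q -> mvn_equiv dot M p q -> q = p.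

Definition abelian_projection (R : realType) (H : completeNormedModType R[i])
    (dot : {dot H for Num.conj}) (M : set (H -> H)) (p : H -> H) : Prop :=
  projection_in dot M p /\
  forall S T, M S -> M T ->
    (p \o S \o p) \o (p \o T \o p) = (p \o T \o p) \o (p \o S \o p).

(* The subscript 1 means that the identity is finite; since it is nonzero,
   type II then amounts to the absence of nonzero abelian projections. *)
Definition II1_factor (R : realType) (H : completeNormedModType R[i])
    (dot : {dot H for Num.conj}) (M : set (H -> H)) : Prop :=
  [/\ factor dot M,
      finite_projection dot M idfun &
      forall p, abelian_projection dot M p -> p = 0].

(* \o and - have the same precedence: the parentheses matter. *)
Definition commutator (R : realType) (H : completeNormedModType R[i])
    (B C : H -> H) : H -> H :=
  (B \o C) - (C \o B).

Definition Comm (R : realType) (H : completeNormedModType R[i])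
    (A : set (H -> H)) : set (H -> H) :=
  [set commutator B C | B in A & C in A].

(* Main.v *)
Require Import Defs.
From HB Require Import structures.
From mathcomp Require Import all_boot all_order all_algebra.
From mathcomp Require Import all_classical all_reals all_analysis.
From mathcomp Require Import ring lra.
Import Order.TTheory GRing.Theory Num.Theory.
Import numFieldNormedType.Exports.
Local Open Scope classical_set_scope.
Local Open Scope ring_scope.

(** The kernels of the powers of a nilpotent T form a flag
    0 = ker T^0 <= ker T <= ... <= ker T^n = H with T (ker T^(i+1)) <= ker T^i,
    so T is strictly upper triangular in the resulting block decomposition.
    If e_0, ..., e_(n-1) are the projections onto the blocks and B = sum_i i e_i,
    then [B, -] multiplies the (i, j) block by i - j.  The diagonal blocks of T
    vanish, hence dividing its (i, j) block by i - j for i <> j gives C with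
    [B, C] = T.  This is [commutator_of_zero_diagonal], which is pure algebra and
    uses only e_i e_j = 0 for i <> j, sum_i e_i = 1 and e_i T e_i = 0.

    The e_i have to lie in M, and this is where the von Neumann algebra enters:
    M contains the orthogonal projection onto the kernel of each of its elements A
    ([kernel_projection]).  By the bicommutant property it suffices that this
    projection commutes with every bounded S commuting with M.  Such an S commutes
    with both A and its adjoint, so it maps ker A into itself and the closure of
    the range of the adjoint into itself; since H is the orthogonal sum of these
    two subspaces, S commutes with the projection.  Working with the range of the
    adjoint, rather than with the orthogonal complement of ker A, spares the
    construction of an adjoint for S.

    The orthogonal sum comes from completeness ([orthogonal_decomposition]): the
    points of a subspace V that nearly minimize the distance to x form a Cauchy
    filter, by the parallelogram law, and its limit y has x - y orthogonal to V. *)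

(** * Blocks with zero diagonal *)

Lemma linear_zero (K : pzRingType) (U V : lmodType K) (f : U -> V) :
  linear f -> f 0 = 0.
Proof. by move=> f_lin; have := f_lin (-1) 0 0; rewrite !scaleN1r !addNr. Qed.

Lemma linear_sub (K : pzRingType) (U V : lmodType K) (f : U -> V) :
  linear f -> forall x y, f (x - y) = f x - f y.
Proof. by move=> f_lin x y; rewrite addrC -scaleN1r f_lin scaleN1r addrC. Qed.

(** With B = sum_i l_i e_i, the commutator [B, -] acts on the block e_i X e_j as
    multiplication by l_i - l_j.  The terms with i = j in the second operator
    are harmless whatever the value of 0^-1, because e_i T e_i = 0. *)
Lemma commutator_of_zero_diagonal (K : fieldType) (V : lmodType K) (n : nat)
    (e : 'I_n -> V -> V) (l : 'I_n -> K) (T : V -> V) :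
  injective l -> (forall i, linear (e i)) -> linear T ->
  (forall i j x, e i (e j x) = if i == j then e i x else 0) ->
  (forall x, \sum_i e i x = x) -> (forall i x, e i (T (e i x)) = 0) ->
  T = ((\sum_i l i *: e i) \o
       (\sum_i \sum_j (l i - l j)^-1 *: (e i \o T \o e j))) -
      ((\sum_i \sum_j (l i - l j)^-1 *: (e i \o T \o e j)) \o
       (\sum_i l i *: e i)).
Proof.
move=> l_inj e_lin T_lin ee e1 eTe.
set B := (\sum_i l i *: e i); set C := (\sum_i \sum_j _).
(* the linear structures give access to the library lemmas on linear maps *)
pose eL i := HB.pack_for {linear V -> V} (e i)
  (GRing.isLinear.Build _ _ _ _ (e i) (e_lin i)).
pose TL := HB.pack_for {linear V -> V} T
  (GRing.isLinear.Build _ _ _ _ T T_lin).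
have eS i (F : 'I_n -> V) : e i (\sum_j F j) = \sum_j e i (F j).
  exact: (linear_sum (eL i)).
have TS (F : 'I_n -> V) : T (\sum_j F j) = \sum_j T (F j).
  exact: (linear_sum TL).
have eZ i a x : e i (a *: x) = a *: e i x by exact: (linearZ_LR (eL i)).
have TZ a x : T (a *: x) = a *: T x by exact: (linearZ_LR TL).
have BE x : B x = \sum_i l i *: e i x by rewrite /B fct_sumE.
have CE x : C x = \sum_i \sum_j (l i - l j)^-1 *: e i (T (e j x)).
  rewrite /C fct_sumE; apply: eq_bigr => i _; by rewrite fct_sumE.
have eB j x : e j (B x) = l j *: e j x.
  rewrite BE eS (bigD1 j)//= eZ ee eqxx big1 ?addr0// => i ij.
  by rewrite eZ ee eq_sym (negPf ij) scaler0.
have eC i x : e i (C x) = \sum_j (l i - l j)^-1 *: e i (T (e j x)).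
  rewrite CE eS (bigD1 i)//= [X in _ + X]big1 ?addr0 => [|k ki].
    by rewrite eS; apply: eq_bigr => j _; rewrite eZ ee eqxx.
  by rewrite eS big1// => j _; rewrite eZ ee eq_sym (negPf ki) scaler0.
apply/funext => x; rewrite !fctE /= (BE (C x)) (CE (B x)) -sumrB.
rewrite -[LHS]e1; apply: eq_bigr => i _.
rewrite eC scaler_sumr -sumrB -{1}[x]e1 TS eS; apply: eq_bigr => j _.
rewrite eB TZ eZ !scalerA -scalerBl.
have [<-|ij] := eqVneq i j; first by rewrite eTe scaler0.
rewrite mulrC -mulrBr mulVf ?scale1r// subr_eq0.
by apply: contra_neq ij => /l_inj.
Qed.

(** * Dot products *)

Section dot_product.
Context {C : numClosedFieldType} {U : lmodType C} (dot : {dot U for Num.conj}).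

(** Pythagoras for the component of u orthogonal to z.  Nonnegativity of the left
    side is the Cauchy-Schwarz inequality, and its being bounded below over a
    subspace makes near minimizers nearly orthogonal to that subspace. *)
Lemma dot_residual u z : z != 0 ->
  dot (u - (dot u z / dot z z) *: z) (u - (dot u z / dot z z) *: z) =
  dot u u - `|dot u z| ^+ 2 / dot z z.
Proof.
move=> z0; have zz : dot z z != 0 by rewrite dnorm_eq0.
have zzR : (dot z z)^* = dot z z by apply: geC0_conj.
have cE : (dot u z / dot z z)^* = (dot u z)^* / dot z z.
  by rewrite fmorph_div/= zzR.
rewrite dnormB dnormZ normCK linearZr_LR/= !rmorphM/= ?conjCK ?cE !fmorphV/=.
rewrite ?zzR ?conjCK normCK.
by field.
Qed.

Lemma cauchy_schwarz u z : `|dot u z| ^+ 2 <= dot u u * dot z z.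
Proof.
have [->|z0] := eqVneq z 0.
  by rewrite linear0r [dot 0 0]linear0r normr0 expr0n mulr0.
by rewrite -ler_pdivrMr ?dnorm_gt0// -subr_ge0 -dot_residual.
Qed.

Lemma norm_sqr_add_le (a b : C) : `|a + b| ^+ 2 <= 2 * (`|a| ^+ 2 + `|b| ^+ 2).
Proof.
rewrite -subr_ge0 (_ : _ - _ = `|a - b| ^+ 2) ?exprn_ge0//.
by rewrite !normCK !rmorphD/= rmorphN/=; ring.
Qed.

Lemma parallelogram u v :
  dot (u + v) (u + v) + dot (u - v) (u - v) = 2 * (dot u u + dot v v).
Proof. by rewrite dnormD dnormB; ring. Qed.

End dot_product.

(** * Orthogonal decomposition in a Hilbert space *)

Section hilbert_space.
Local Open Scope complex_scope.
Context {R : realType} {H : completeNormedModType R[i]}.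
Context (dot : {dot H for Num.conj}) (dot_norm : induces_norm dot).

(** Real-valued, so that infima exist and linear arithmetic applies; the norm of
    H takes its values in R[i]. *)
Definition sqnorm (x : H) : R := complex.Re (dot x x).

Lemma sqnormE x : (sqnorm x)%:C = dot x x.
Proof. by rewrite /sqnorm RRe_real// ger0_real. Qed.

Lemma sqnorm_ge0 x : 0 <= sqnorm x.
Proof. by rewrite -ler0c sqnormE. Qed.

Lemma sqnorm_scale (a : R) x : sqnorm (a%:C *: x) = a ^+ 2 * sqnorm x.
Proof.
apply: complexI; rewrite rmorphM rmorphXn/= !sqnormE dnormZ.
by rewrite real_normK// complex_real.
Qed.

Lemma sqnorm_parallelogram u v :
  sqnorm (u + v) + sqnorm (u - v) = 2 * (sqnorm u + sqnorm v).
Proof.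
apply: complexI; rewrite rmorphM/= !rmorphD/= !sqnormE parallelogram.
by rewrite rmorph1.
Qed.

Lemma norm_lt_sqnorm x (e : R) : 0 < e -> (`|x| < e%:C) = (sqnorm x < e ^+ 2).
Proof.
move=> e0; rewrite -ltcR rmorphXn/= sqnormE -dot_norm.
by rewrite ltr_pXn2r// nnegrE ?ler0c// ltW.
Qed.

(** The midpoint of y and y' is again in V, so it is at squared distance at least
    d from x; the parallelogram law then bounds the distance from y to y'. *)
Lemma near_minimizers (V : set H) (x : H) (d e : R) :
  (forall c u v, V u -> V v -> V (c *: u + v)) ->
  (forall y, V y -> d <= sqnorm (x - y)) ->
  forall y y', V y -> V y' ->
  sqnorm (x - y) < d + e -> sqnorm (x - y') < d + e ->
  sqnorm (y - y') < 4 * e.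
Proof.
move=> Vlin Vd y y' Vy Vy' yd y'd.
have V0 : V 0 by rewrite -(addNr y) -scaleN1r; exact: Vlin.
pose m := (2^-1)%:C *: (y + y').
have Vm : V m.
  rewrite /m -[X in V X]addr0; apply: (Vlin) => //.
  by rewrite -[y]scale1r; exact: Vlin.
have two : (2 : R)%:C *: (x - m) = (x - y) + (x - y').
  rewrite scalerBr scalerA -rmorphM/= divff ?pnatr_eq0// rmorph1 scale1r.
  rewrite rmorphD rmorph1 scalerDl scale1r.
  by rewrite opprD addrACA.
have := sqnorm_parallelogram (x - y) (x - y').
rewrite -two sqnorm_scale (_ : x - y - (x - y') = y' - y); last first.
  by rewrite opprB addrC addrA subrK.
have -> : sqnorm (y - y') = sqnorm (y' - y).
  by rewrite -(opprB y y') /sqnorm hnormN.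
have := Vd _ Vm; lra.
Qed.

Lemma sqr_norm_le_eps_eq0 (w : R[i]) (k : R) :
  (forall e, 0 < e -> `|w| ^+ 2 <= (e * k)%:C) -> w = 0.
Proof.
move=> small; apply/eqP; rewrite -normr_eq0 -sqrf_eq0 -add_Re2_Im2 eq_le ler0c.
rewrite addr_ge0 ?sqr_ge0// andbT (lecR _ 0).
have k0 : 0 <= k by have := small 1 ltr01; rewrite mul1r -add_Re2_Im2 lecR;
  apply: le_trans; rewrite addr_ge0 ?sqr_ge0.
apply/ler_addgt0Pl => t t0; rewrite addr0.
have k1 : 0 < k + 1 by rewrite ltr_wpDl.
have := small (t / (k + 1)); rewrite -add_Re2_Im2 lecR => /(_ (divr_gt0 t0 k1)).
move/le_trans; apply.
by rewrite mulrAC ler_pdivrMr// ler_wpM2l ?lerDl// ltW.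
Qed.

(** V need not be closed: the limit y of near minimizers lies in its closure, and
    near minimizers are nearly orthogonal to V. *)
Lemma orthogonal_decomposition (V : set H) (x : H) :
  V 0 -> (forall c u v, V u -> V v -> V (c *: u + v)) ->
  exists2 y, closure V y & forall z, V z -> dot (x - y) z = 0.
Proof.
move=> V0 Vlin; pose A := [set sqnorm (x - y) | y in V]; pose d := inf A.
have A0 : has_inf A.
  split; first by exists (sqnorm (x - 0)); exists 0.
  by exists 0 => _ [y _ <-]; exact: sqnorm_ge0.
have dle y : V y -> d <= sqnorm (x - y).
  by move=> Vy; apply: ge_inf; [exact: A0.2|exists y].
pose S e := [set y | V y /\ sqnorm (x - y) < d + e].
pose F := filter_from [set e : R | 0 < e] S.
have SS e e' : e <= e' -> S e `<=` S e'.
  by move=> ee' y [Vy ye]; split => //; lra.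
have FF : ProperFilter F.
  apply: filter_from_proper => [|e /= e0].
    apply: filter_from_filter; first by exists 1 => /=.
    move=> e e' /= e0 e'0; exists (Num.min e e'); first by rewrite lt_min e0.
    by rewrite subsetI; split; apply: SS; rewrite ge_min lexx ?orbT.
  by have [_ [y Vy <-] yd] := inf_adherent e0 A0; exists y.
have /cauchy_cvgP Fcvg : cauchy F.
  apply: cauchy_exP => eps eps0.
  have epsE : (complex.Re eps)%:C = eps by rewrite RRe_real// gtr0_real.
  have r0 : 0 < complex.Re eps by rewrite -ltcR epsE.
  (* two points of S (r ^+ 2 / 4) are at squared distance below r ^+ 2 *)
  have e0 : 0 < complex.Re eps ^+ 2 / 4 by rewrite divr_gt0// exprn_gt0.
  have [_ [y Vy <-] yd] := inf_adherent e0 A0.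
  exists y; exists (complex.Re eps ^+ 2 / 4) => // y' [Vy' y'd] /=.
  rewrite -ball_normE /ball_ /= -epsE norm_lt_sqnorm//.
  have := near_minimizers V x d _ Vlin dle y y' Vy Vy' yd y'd.
  by rewrite mulrC divfK.
have {Fcvg} [y0 Fy0] : exists y0 : H, F --> y0 by exists (lim F).
have near e : 0 < e -> exists2 y, S e y & sqnorm (y - y0) < e.
  move=> e0; have s0 : 0 < Num.sqrt e by rewrite sqrtr_gt0.
  have /Fy0 Fb : nbhs y0 (ball y0 (Num.sqrt e)%:C).
    by apply: nbhsx_ballx; rewrite ltcR.
  have FS : F (S e) by exists e.
  have [y [Sy]] := filter_ex (filterI FS Fb).
  rewrite -ball_normE /ball_ /= distrC norm_lt_sqnorm// sqr_sqrtr ?ltW//.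
  by exists y.
exists y0.
  move=> B /nbhs_ballP[eps /= eps0 epsB].
  have /Fy0 [e e0 SB] : nbhs y0 (ball y0 eps) by exact: nbhsx_ballx.
  have [y Sy _] := near e e0.
  by exists y; split; [exact: Sy.1|exact/epsB/SB].
move=> z Vz; have [->|z0] := eqVneq z 0; first by rewrite linear0r.
(* moving from y along z cannot bring the squared distance to x below d *)
have nearly e y : S e y -> `|dot (x - y) z| ^+ 2 <= e%:C * dot z z.
  move=> [Vy yd]; rewrite -ler_pdivrMr ?dnorm_gt0//.
  have := dot_residual dot (x - y) z z0; set c := _ / _ => res.
  rewrite -[leLHS](subKr (dot (x - y) (x - y))) -res -!sqnormE -rmorphB/= lecR.
  have := dle (c *: z + y) (Vlin _ _ _ Vz Vy).
  rewrite opprD addrCA addrC; move: yd; lra.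
have bound e : 0 < e -> `|dot (x - y0) z| ^+ 2 <= (4 * e)%:C * dot z z.
  move=> e0; have [y Sy yy0] := near e e0.
  rewrite -(subrK y x) -addrA linearDl; apply: (le_trans (norm_sqr_add_le _ _)).
  have -> : (4 * e)%:C * dot z z = 2 * (e%:C * dot z z + e%:C * dot z z).
    by rewrite rmorphM/= rmorph_nat; ring.
  rewrite ler_wpM2l// lerD ?nearly//.
  apply: (le_trans (cauchy_schwarz dot _ z)).
  by rewrite ler_wpM2r// -sqnormE lecR ltW.
apply: (sqr_norm_le_eps_eq0 _ (4 * sqnorm z)) => e e0.
by rewrite mulrCA mulrA rmorphM/= sqnormE; exact: bound.
Qed.

Lemma orthogonal_closure (V : set H) (w : H) :
  (forall z, V z -> dot w z = 0) -> forall z, closure V z -> dot w z = 0.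
Proof.
move=> wV z Vz; apply: (sqr_norm_le_eps_eq0 _ (sqnorm w)) => e e0.
have s0 : 0 < Num.sqrt e by rewrite sqrtr_gt0.
have [z' [Vz' zz']] : V `&` ball z (Num.sqrt e)%:C !=set0.
  by apply: Vz; apply: nbhsx_ballx; rewrite ltcR.
move: zz'; rewrite -ball_normE /ball_ /= norm_lt_sqnorm// sqr_sqrtr ?(ltW e0)//.
move=> ze.
have -> : dot w z = dot w (z - z').
  by rewrite linearBr/= [X in _ - X](wV z')// subr0.
apply: (le_trans (cauchy_schwarz dot _ _)).
rewrite -!sqnormE -rmorphM/= lecR mulrC ler_wpM2r ?sqnorm_ge0//.
exact: ltW.
Qed.

Lemma closure_stable (V : set H) (S : H -> H) :
  continuous S -> (forall z, V z -> V (S z)) ->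
  forall z, closure V z -> closure V (S z).
Proof.
move=> Sc SV z Vz B /Sc SB.
by have [y [Vy By]] := Vz _ SB; exists (S y); split => //; exact: SV.
Qed.

Lemma contraction_continuous (p : H -> H) :
  linear p -> (forall x, sqnorm (p x) <= sqnorm x) -> continuous p.
Proof.
move=> p_lin p_le x; apply/cvgrPdist_lt => e e0.
have ple u : `|p u| <= `|u|.
  by rewrite -(@ler_pXn2r _ 2)// ?nnegrE// !dot_norm -!sqnormE lecR.
near=> t; rewrite -(linear_sub _ _ _ _ p_lin) (le_lt_trans (ple _))//.
Unshelve. all: by end_near. Qed.

(** * Kernel projections in a von Neumann algebra *)

(** H is the orthogonal sum of ker A and the closure of the range of the adjoint
    A' of A.  An operator that commutes with A and A' preserves both summands,
    hence commutes with the projection p onto the first one along the second. *)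
Lemma kernel_projection (M : set (H -> H)) (A : H -> H) :
  von_neumann_algebra dot M -> M A ->
  exists p, [/\ projection_in dot M p, forall x, A (p x) = 0 &
    forall x, A x = 0 -> p x = x].
Proof.
move=> HM MA; have [A_lin _] := vna_bounded HM MA.
have [A' MA' AA'] := vna_adjoint HM MA; have [A'_lin _] := vna_bounded HM MA'.
(* W is the orthogonal complement of ker A; unlike closure V, it is closed under
   linear combinations without any argument *)
pose V := range A'; pose W := [set y | forall w, A w = 0 -> dot w y = 0].
have VW : closure V `<=` W.
  move=> y Vy w Aw; apply: (orthogonal_closure V) Vy => _ [z _ <-].
  by rewrite -AA' Aw linear0l.
have decomp x : exists w, A w = 0 /\ closure V (x - w).
  have [||y Vy xy] := orthogonal_decomposition V x.
  - by exists 0 => //; exact: linear_zero.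
  - move=> c _ _ [u _ <-] [v _ <-]; exists (c *: u + v) => //; exact: A'_lin.
  exists (x - y); split; last by rewrite subKr.
  by apply/eqP; rewrite -(dnorm_eq0 dot) AA' xy//; exists (A (x - y)).
have [p pP] := choice decomp.
have Ap x : A (p x) = 0 by have [] := pP x.
have Vp x : closure V (x - p x) by have [] := pP x.
(* the difference of two candidates lies in both ker A and its complement *)
have p_uniq x w : A w = 0 -> W (x - w) -> p x = w.
  move=> Aw Wxw; apply/eqP; rewrite -subr_eq0 -(dnorm_eq0 dot); apply/eqP.
  have Apw : A (p x - w) = 0.
    by rewrite (linear_sub _ _ _ _ A_lin) Aw Ap subr0.
  rewrite {2}(_ : p x - w = (x - w) - (x - p x)); last first.
    by rewrite opprB [RHS]addrC addrA subrK.
  by rewrite linearBr -[RHS](subrr 0); congr (_ - _); [exact: Wxw | exact: VW].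
have p_lin : linear p.
  move=> c x y; apply: p_uniq; first by rewrite A_lin !Ap scaler0 addr0.
  move=> w Aw; rewrite opprD addrACA -scalerBr linearDr linearZr_LR/=.
  by rewrite !(VW _ (Vp _))// mulr0 addr0.
have p_cont : continuous p.
  apply: contraction_continuous => // x.
  have pxx := VW _ (Vp x) _ (Ap x).
  have -> : sqnorm x = sqnorm (p x) + sqnorm (x - p x).
    apply: complexI; rewrite rmorphD/= !sqnormE -hnormDd//.
    by rewrite addrC subrK.
  by rewrite lerDl sqnorm_ge0.
have pT x : A x = 0 -> p x = x.
  by move=> Ax; apply: p_uniq => // w _; rewrite subrr linear0r.
exists p; split=> //.
split.
- rewrite -(vna_bicommutant HM); split=> // S [[S_lin S_cont] SM].
  have SA x : S (A x) = A (S x) by have /(congr1 (@^~ x)) := SM A MA.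
  have SA' x : S (A' x) = A' (S x) by have /(congr1 (@^~ x)) := SM A' MA'.
  apply/funext => x /=; apply: p_uniq; first by rewrite -SA Ap linear_zero.
  apply: VW; rewrite -(linear_sub _ _ _ _ S_lin).
  apply: closure_stable => // _ [z _ <-].
  by exists (S z).
- by apply/funext => x /=; exact: pT.
- have pE x y : dot (p x) y = dot (p x) (p y).
    by apply/eqP; rewrite -subr_eq0 -linearBr; apply/eqP; exact: VW.
  move=> x y; rewrite pE [LHS]hermC [RHS]hermC; congr (_ * Num.conj _).
  by apply: esym; exact: pE.
Qed.

End hilbert_space.

(** * Nilpotent elements *)

Section nilpotent.
Context {R : realType} {H : completeNormedModType R[i]}.
Context (dot : {dot H for Num.conj}) (dot_norm : induces_norm dot).
Context (M : set (H -> H)) (M_vna : von_neumann_algebra dot M).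

Lemma von_neumann_algebra_iter T k : M T -> M (iter k T).
Proof.
move=> MT; elim: k => [|k IH]; first exact: vna_one M_vna.
exact: (vna_mul M_vna MT IH).
Qed.

Lemma von_neumann_algebra_sum (n : nat) (F : 'I_n -> H -> H) :
  (forall i, M (F i)) -> M (\sum_i F i).
Proof.
move=> MF; elim/big_ind: _ => //; last exact: (vna_add M_vna).
rewrite -(scale0r (idfun : H -> H)).
exact: (vna_scale M_vna 0 (vna_one M_vna)).
Qed.

(** Taking adjoints in q p = p exchanges the two factors. *)
Lemma projection_absorb (p q : H -> H) :
  is_adjoint dot p p -> is_adjoint dot q q ->
  (forall x, q (p x) = p x) -> forall x, p (q x) = p x.
Proof.
move=> pp qq qp x; apply/eqP; rewrite -subr_eq0 -(dnorm_eq0 dot); apply/eqP.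
by rewrite linearBl/= pp qq qp -pp subrr.
Qed.

(** The blocks e_i are the differences of consecutive projections p_i onto the
    kernels of the powers of T. *)
Lemma nilpotent_commutator T n : M T -> iter n T = 0 -> Comm M T.
Proof.
move=> MT Tn0; have [T_lin _] := vna_bounded M_vna MT.
have [p pP] := choice (fun k =>
  kernel_projection dot dot_norm M _ M_vna (von_neumann_algebra_iter T k MT)).
have Mp k : M (p k) by have [[]] := pP k.
have p_adj k : is_adjoint dot (p k) (p k) by have [[]] := pP k.
have Tp k x : iter k T (p k x) = 0 by have [_ ->] := pP k.
have pT k x : iter k T x = 0 -> p k x = x by have [_ _] := pP k; apply.
have pp_le i j x : (i <= j)%N -> p j (p i x) = p i x.
  move=> ij; apply: pT; rewrite -(subnK ij) iterD Tp.
  by elim: (j - i)%N => //= k ->; exact: linear_zero.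
have pp i j x : p i (p j x) = p (minn i j) x.
  have [ij|/ltnW ij] := leqP i j; last exact: pp_le.
  by apply: (projection_absorb _ (p j)) => // y; exact: pp_le.
have p_lin k : linear (p k) by have [] := vna_bounded M_vna (Mp k).
have pB k x y : p k (x - y) = p k x - p k y by exact: linear_sub.
pose e (i : 'I_n) : H -> H := fun x => p i.+1 x - p i x.
have Me i : M (e i).
  have := vna_add M_vna (Mp i.+1) (vna_scale M_vna (-1) (Mp i)).
  by rewrite scaleN1r.
have e_lin i : linear (e i) by have [] := vna_bounded M_vna (Me i).
have ee i j x : e i (e j x) = if i == j then e i x else 0.
  rewrite /e !pB !pp.
  have [<-|] := eqVneq i j.
    by rewrite !minnn (minn_idPr (leqnSn i)) (minn_idPl (leqnSn i)) subrr subr0.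
  rewrite -val_eqE /= neq_ltn => /orP[ij|ji].
    by rewrite !(minn_idPl _) ?subrr// ltnW// ltnS ltnW.
  by rewrite !(minn_idPr _) ?subrr// ltnW// ltnS ltnW.
have e1 x : \sum_i e i x = x.
  rewrite -(big_mkord xpredT (fun i => p i.+1 x - p i x)) telescope_sumr//.
  by rewrite pT ?Tn0// (_ : p 0 x = 0) ?subr0//; exact: (Tp 0).
have eTe i x : e i (T (e i x)) = 0.
  (* T maps ker T^(i+1) into ker T^i, where p_i and p_(i+1) both act as 1 *)
  have Te : iter i T (T (e i x)) = 0.
    rewrite -iterSr (_ : e i x = p i.+1 (e i x)) ?Tp//.
    by rewrite /e pB !pp minnn (minn_idPr (leqnSn i)).
  by rewrite [LHS]/e !pT ?subrr// iterS Te linear_zero.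
have nat_inj : injective (fun i : 'I_n => i%:R : R[i]).
  by move=> i j /eqP; rewrite eqr_nat => /eqP/val_inj.
exists (\sum_(i < n) i%:R *: e i).
  by apply: von_neumann_algebra_sum => i; exact: (vna_scale M_vna _ (Me i)).
exists (\sum_(i < n) \sum_(j < n) (i%:R - j%:R)^-1 *: (e i \o T \o e j)).
  apply: von_neumann_algebra_sum => i; apply: von_neumann_algebra_sum => j.
  exact: (vna_scale M_vna _ (vna_mul M_vna (vna_mul M_vna (Me i) MT) (Me j))).
apply/esym; exact: (commutator_of_zero_diagonal R[i] H n e _ T).
Qed.

End nilpotent.

Theorem proposition3p2 (R : realType) (H : completeNormedModType R[i])
    (dot : {dot H for Num.conj}) (M : set (H -> H)) :
  induces_norm dot -> II1_factor dot M ->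
  forall (T : H -> H) (n : nat),
    M T -> (1 <= n)%N -> iter n T = 0 -> Comm M T.
Proof.
move=> dot_norm [[M_vna _ _] _ _] T n MT _.
exact: (nilpotent_commutator dot dot_norm M M_vna).
Qed.
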